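(* There is an absolute constant $c>0$ such that the following holds. Let $n\ge 1$, $x\in\mathbb{R}^n$, let $R\ge 1$ and $k\ge 2$ be integers, and let $\widehat{x}$ be the Count-Sketch estimate of $x$ using $R$ rows and $k$ columns with fully random hash functions. Then for every real $t\le R$ and every index $i\in[n]$, \[ \Pr\left[(\widehat{x}_i - x_i)^2 > \frac{t}{R}\cdot \frac{\|x_{\overline{[k]}}\|_2^2}{k}\right] < 2e^{-ct}. \]
   Context: Count-Sketch with $R$ rows and $C$ columns: for each row $u\in[R]$ choose hash functions $h_u:[n]\to[C]$ and $s_u:[n]\to\{\pm1\}$; ''fully random'' means all values $h_u(i)$ (uniform on $[C]$) and $s_u(i)$ (uniform on $\{\pm1\}$), over all $u$ and $i$, are mutually independent. The sketch is $y_{u,v}=\sum_{i:h_u(i)=v}s_u(i)x_i$ for $u\in[R]$, $v\in[C]$, and the estimate is $\widehat{x}_i=\operatorname{median}_{u\in[R]} s_u(i)\,y_{u,h_u(i)}$ (for even $R$ the median is the average of the two middle values). For $x\in\mathbb{R}^n$, $x_{\overline{[k]}}$ denotes the vector obtained from $x$ by replacing its $k$ largest-magnitude coordinates with $0$. *)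

(* Defs.v *)
From HB Require Import structures.
From mathcomp Require Import all_boot all_order all_algebra.
From mathcomp Require Import all_classical all_reals.
From mathcomp Require Import sequences exp.
Set Implicit Arguments. Unset Strict Implicit. Unset Printing Implicit Defensive.
Import Order.TTheory GRing.Theory Num.Theory.
Local Open Scope ring_scope.

Section CountSketch.
Variable R : realType.

(* Sample space of the fully random hash functions for a Count-Sketch with
   r rows, C columns on [n]:  h : [r] x [n] -> [C],  s : [r] x [n] -> {+1,-1}
   (true encodes +1, false encodes -1).  "Fully random" = uniform measure on
   this finite product space. *)
Definition CSspace (r n C : nat) : finType :=
  ({ffun 'I_r * 'I_n -> 'I_C} * {ffun 'I_r * 'I_n -> bool})%type.

Definition unif_prob (T : finType) (E : pred T) : R :=
  #|[set w : T | E w]|%:R / #|T|%:R.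

Definition sgn (b : bool) : R := if b then 1 else -1.

Definition cs_y r n C (w : CSspace r n C) (x : 'I_n -> R) (u : 'I_r) (v : 'I_C)
  : R :=
  \sum_(i : 'I_n | w.1 (u, i) == v) sgn (w.2 (u, i)) * x i.

Definition median (s : seq R) : R :=
  let ss := sort <=%R s in
  let m := size s in
  if odd m then ss`_(m./2) else (ss`_((m./2).-1) + ss`_(m./2)) / 2.

Definition cs_est r n C (w : CSspace r n C) (x : 'I_n -> R) (i : 'I_n) : R :=
  median [seq sgn (w.2 (u, i)) * cs_y w x u (w.1 (u, i)) | u : 'I_r].

(* ||x_{\overline{[k]}}||_2^2 : sum of squares of x after zeroing its k
   largest-magnitude coordinates = sum of the n-k smallest values of x_j^2 *)
Definition tail_sqnorm n (x : 'I_n -> R) (k : nat) : R :=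
  \sum_(a <- take (n - k) (sort <=%R [seq x j ^+ 2 | j : 'I_n])) a.

End CountSketch.

(* Main.v *)
(* Up to sign, the error of a row is a sum of independent terms z_j x_j, where z_j
   is 1 or -1 with probability 1/(2k) each and 0 otherwise. Since k >= 2, z_j is
   the difference of two independent Bernoulli(p) variables, where
   p (1 - p) = 1/(2k); so the error is T - T' with T, T' independent and
   identically distributed. Let s^2 be the squared tail norm over k. With
   probability at least e^-2 no head coordinate occurs in T, and then T lies within
   s of its mean with probability at least 1/2. Splitting this window of width 2s
   into at most 3/e bins of width e s and using sum_b P(b)^2 >= (sum_b P(b))^2 / #bins,
   T and T' fall in the same bin, hence |error| <= e s, with probability at least a
   constant times e, for every 0 < e <= 1. The error is symmetric, so it exceeds
   e s with probability at most 1/2 - const * e, and a Chernoff bound over the rows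
   with e^2 = t/R controls each tail of the median. *)
Require Import Defs.
From HB Require Import structures.
From mathcomp Require Import all_boot all_order all_algebra.
From mathcomp Require Import all_classical all_reals.
From mathcomp Require Import sequences exp.
From mathcomp Require Import zify ring lra.
Import Order.TTheory GRing.Theory Num.Theory.
Local Open Scope ring_scope.

(** * The median and the tail norm as order statistics *)

(** All sorted entries from position [(size s)./2] on exceed [c]: for even size the larger of the
    two middle values is at least their average. They make up at least half of the list. *)
Lemma count_ge_median {R : realType} (s : seq R) (c : R) :
  s != [::] -> c < median s -> (size s <= (count (> c) s).*2)%N.
Proof.
move=> s0; rewrite /median; set ss := sort _ _ => cm.
have szs : size ss = size s by rewrite size_sort.
have ssort : sorted <=%R ss by apply: sort_sorted; exact: le_total.
have sz0 : (0 < size s)%N by rewrite lt0n size_eq0.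
have half : ((size s)./2 < size ss)%N by rewrite szs -divn2 ltn_Pdiv.
have mono a b : (a <= b)%N -> (b < size ss)%N -> ss`_a <= ss`_b.
  move=> ab bs; apply: (sorted_leq_nth le_trans le_refl 0 ssort) => //.
  by rewrite inE (leq_ltn_trans ab).
have mid : c < ss`_((size s)./2).
  move: cm; case: ifP => // _ cm.
  by have := mono _ _ (leq_pred _) half; lra.
have -> : count (> c) s = count (> c) ss by apply/permP; rewrite perm_sym perm_sort.
rewrite -[X in count _ X](cat_take_drop (size s)./2) count_cat.
have -> : count (> c) (drop (size s)./2 ss) = size (drop (size s)./2 ss).
  apply/eqP; rewrite -all_count; apply/(all_nthP 0) => j; rewrite size_drop nth_drop => hj.
  by apply: lt_le_trans mid _; apply: mono; rewrite ?leq_addr // -ltn_subRL.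
rewrite size_drop szs doubleD.
apply: leq_trans (leq_addl _ _).
have := odd_double_half (size s); case: odd; lia.
Qed.

Lemma count_le_median {R : realType} (s : seq R) (c : R) :
  s != [::] -> median s < c -> (size s <= (count (< c) s).*2)%N.
Proof.
move=> s0; rewrite /median; set ss := sort _ _ => cm.
have szs : size ss = size s by rewrite size_sort.
have ssort : sorted <=%R ss by apply: sort_sorted; exact: le_total.
have sz0 : (0 < size s)%N by rewrite lt0n size_eq0.
have half : ((size s)./2 < size ss)%N by rewrite szs -divn2 ltn_Pdiv.
have mono a b : (a <= b)%N -> (b < size ss)%N -> ss`_a <= ss`_b.
  move=> ab bs; apply: (sorted_leq_nth le_trans le_refl 0 ssort) => //.
  by rewrite inE (leq_ltn_trans ab).
(* The lower middle position: the middle itself for odd size, the smaller of the two middle ones for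
   even size. *)
set m := ((uphalf (size s)).-1)%N.
have um : (m.+1 = uphalf (size s))%N.
  by rewrite /m prednK // uphalf_gt0.
have mid : ss`_m < c.
  move: cm; rewrite /m uphalf_half; case: ifP => [o|_] cm; first by [].
  by rewrite add0n; have := mono _ _ (leq_pred _) half; lra.
have ms : (m.+1 <= size ss)%N.
  by rewrite um szs uphalf_half; have := odd_double_half (size s); case: odd; lia.
have -> : count (< c) s = count (< c) ss by apply/permP; rewrite perm_sym perm_sort.
rewrite -[X in count _ X](cat_take_drop m.+1) count_cat.
have -> : count (< c) (take m.+1 ss) = size (take m.+1 ss).
  apply/eqP; rewrite -all_count; apply/(all_nthP 0) => j; rewrite size_takel // => hj; rewrite nth_take //.
  by apply: le_lt_trans mid; apply: mono.
rewrite size_takel // um doubleD.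
apply: leq_trans (leq_addr _ _).
by rewrite uphalf_half; have := odd_double_half (size s); case: odd; lia.
Qed.

(** [H] collects the indices at the last [k] places of a sort by [x j ^+ 2]; when [n < k] it is
    everything, hence only [#|H| <= k]. *)
Lemma tail_sqnormE {R : realType} n (x : 'I_n -> R) k :
  exists2 H : {set 'I_n}, (#|H| <= k)%N & \sum_(j | j \notin H) x j ^+ 2 = tail_sqnorm x k.
Proof.
pose s := sort (relpre (fun j => x j ^+ 2) <=%R) (enum 'I_n).
have us : uniq s by rewrite sort_uniq enum_uniq.
have szs : size s = n by rewrite size_sort size_enum_ord.
exists [set j in drop (n - k) s].
  rewrite cardsE; apply: leq_trans (card_size _) _.
  by rewrite size_drop szs; lia.
rewrite /tail_sqnorm sort_map -map_take big_map -/s.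
rewrite big_uniq ?take_uniq //=.
apply: eq_bigl => j; rewrite inE.
have : j \in take (n - k) s ++ drop (n - k) s by rewrite cat_take_drop mem_sort mem_enum.
rewrite mem_cat; move: us; rewrite -(cat_take_drop (n - k) s) cat_uniq cat_take_drop => /and3P[_ /hasPn dis _].
case jt: (j \in take _ _); case jd: (j \in drop _ _) => //.
by have := dis _ jd; rewrite /= jt.
Qed.

(** * Uniform probability on finite spaces and a Chernoff bound *)

Section FiniteProbability.
Context {R : realType}.

Lemma unif_probE {T : finType} (E : pred T) :
  unif_prob R E = (\sum_w (E w)%:R) / #|T|%:R.
Proof.
rewrite /unif_prob; congr (_ / _).
rewrite cardsE -sum1_card natr_sum big_mkcond /=.
by apply: eq_bigr => w _; rewrite unfold_in; case: (E w).
Qed.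

Lemma unif_prob_le {T : finType} (E F : pred T) :
  {subset E <= F} -> unif_prob R E <= unif_prob R F.
Proof.
move=> sEF; rewrite /unif_prob ler_wpM2r ?invr_ge0 // ler_nat.
by apply: subset_leq_card; apply/fintype.subsetP => w; rewrite !inE; exact: sEF.
Qed.

Lemma unif_prob_le1 {T : finType} (E : pred T) : unif_prob R E <= 1.
Proof.
rewrite /unif_prob; have [->|T0] := posnP #|T|; first by rewrite invr0 mulr0.
by rewrite ler_pdivrMr ?ltr0n // mul1r ler_nat max_card.
Qed.

Lemma unif_probU {T : finType} (E F : pred T) :
  unif_prob R (predU E F) <= unif_prob R E + unif_prob R F.
Proof.
rewrite /unif_prob -mulrDl ler_wpM2r ?invr_ge0 // -natrD ler_nat.
by apply: leq_trans (leq_card_setU _ _); apply: subset_leq_card; apply/fintype.subsetP => w; rewrite !inE.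
Qed.

Lemma unif_prob_bij {T U : finType} (f : T -> U) (E : pred U) :
  bijective f -> unif_prob R (E \o f) = unif_prob R E.
Proof.
move=> bf; rewrite !unif_probE (bij_eq_card bf) [in RHS](reindex f) //.
exact: onW_bij.
Qed.

(** The fibre over [z] is a product of fibres, so the sum over it factors by distributivity: images
    of independent coordinates are independent. It brings a row of the sketch and a difference of
    Bernoulli vectors to a common law. *)
Lemma sum_prod_pushforward {I A B : finType} (w : I -> A -> R) (f : I -> A -> B)
    (F : {ffun I -> B} -> R) :
  \sum_(g : {ffun I -> A}) (\prod_j w j (g j)) * F [ffun j => f j (g j)] =
  \sum_(z : {ffun I -> B}) (\prod_j \sum_(a | f j a == z j) w j a) * F z.
Proof.
rewrite (partition_big (fun g : {ffun I -> A} => [ffun j => f j (g j)]) xpredT) //=.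
apply: eq_bigr => z _; rewrite bigA_distr_big_dep mulr_suml; apply: eq_big => g.
  apply/eqP/familyP => [<- j|fz]; first by rewrite unfold_in /= ffunE.
  by apply/ffunP => j; rewrite ffunE; apply/eqP/(fz j).
by move=> /eqP ->.
Qed.

(* Markov's inequality for the product over the rows of [b] on success and [b^-1]
   on failure, with [b = 1 + a]. *)
Lemma chernoff_half {T : finType} (P : pred T) (r : nat) (a : R) :
  0 <= a <= 1 -> unif_prob R P <= 1 / 2 - a ->
  unif_prob R (fun g : {ffun 'I_r -> T} => (r <= (#|[set u | P (g u)]|).*2)%N)
    <= expR (- (a ^+ 2 / 2 * r%:R)).
Proof.
move=> /andP[a0 a1] Pa; pose b := 1 + a.
have b0 : 0 < b by rewrite /b; lra.
have b1 : 1 <= b by rewrite /b; lra.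
pose F (v : T) : R := if P v then b else b^-1.
have F0 v : 0 <= F v by rewrite /F; case: ifP; rewrite ?invr_ge0 ltW.
have [T0|Tpos] := posnP #|T|.
  case: r => [|r]; first by rewrite mulr0 oppr0 expR0 unif_prob_le1.
  rewrite unif_probE big1 ?mul0r ?expR_ge0 // => g _.
  by have := fintype0 (g ord0) T0.
have cT : (0 : R) < #|T|%:R by rewrite ltr0n.
(* If at least half of the rows succeed, the exponents of [b >= 1] add up to a nonnegative
   number. *)
have ind (g : {ffun 'I_r -> T}) :
    ((r <= (#|[set u | P (g u)]|).*2)%N)%:R <= \prod_u F (g u).
  case: (leqP r) => [hr|_]; last by apply: prodr_ge0.
  rewrite (bigID (fun u => P (g u))) /=.
  rewrite (eq_bigr (fun=> b)) => [|u Pu]; last by rewrite /F Pu.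
  rewrite [X in _ * X](eq_bigr (fun=> b^-1)) => [|u /negbTE Pu]; last by rewrite /F Pu.
  rewrite !prodr_const exprVn.
  rewrite ler_pdivlMr ?exprn_gt0 // mul1r; apply: ler_weXn2l => //.
  have := cardC [set u | P (g u)]; rewrite card_ord => hc.
  have -> : #|[pred u | P (g u)]| = #|[set u | P (g u)]| by rewrite cardsE.
  have -> : #|[pred u | ~~ P (g u)]| = #|[predC [set u | P (g u)]]|.
    by apply: eq_card => u; rewrite !inE.
  by rewrite -(leq_add2l #|[set u | P (g u)]|) hc addnn.
(* At success probability [1/2 - a] the mean of [F] is [1 - a^2 (3/2 + a) / (1 + a)], which is at
   most [1 - a^2 / 2]. *)
have sumF : \sum_v F v <= #|T|%:R * expR (- (a ^+ 2 / 2)).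
  have -> : \sum_v F v = #|T|%:R * (b^-1 + (b - b^-1) * unif_prob R P).
    rewrite unif_probE (eq_bigr (fun v => b^-1 + (b - b^-1) * (P v)%:R)); last first.
      by move=> v _; rewrite /F; case: (P v); rewrite ?mulr1 ?mulr0 ?addr0 // addrC subrK.
    rewrite big_split /= sumr_const -mulr_sumr -mulr_natl.
    by field; rewrite !gt_eqF.
  rewrite ler_pM2l //.
  apply: le_trans (expR_ge1Dx _).
  have bc : b^-1 * b = 1 by rewrite mulVf // gt_eqF.
  have c0 : 0 < b^-1 by rewrite invr_gt0.
  have c1 : b^-1 <= 1 by rewrite invf_le1.
  have : (b - b^-1) * unif_prob R P <= (b - b^-1) * (1 / 2 - a).
    by apply: ler_wpM2l => //; lra.
  have : b^-1 = 1 - b^-1 * a by rewrite -{1}bc /b; lra.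
  have : b^-1 * a ^+ 2 <= a ^+ 2 by rewrite ler_piMl // sqr_ge0.
  rewrite /b; move: (1 + a)^-1 c0 c1 (unif_prob R P) => c *; nra.
rewrite unif_probE card_ffun card_ord natrX ler_pdivrMr ?exprn_gt0 //.
apply: le_trans (ler_sum _ (fun g _ => ind g)) _.
rewrite -(bigA_distr_bigA (fun=> F)) prodr_const card_ord.
rewrite -mulNr expRM_natr mulrC -exprMn.
by apply: lerXn2r; rewrite ?nnegrE ?sumr_ge0 ?mulr_ge0 ?expR_ge0.
Qed.

End FiniteProbability.

(** * Anti-concentration of a difference of Bernoulli sums *)

Section AntiConcentration.
Context {R : realType}.

Definition bern (p : R) (b : bool) : R := if b then p else 1 - p.

(** The parameter may depend on the coordinate, so that setting it to 0 switches a coordinate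
    off. *)
Definition bern_prod {I : finType} (q : I -> R) (y : {ffun I -> bool}) : R :=
  \prod_j bern (q j) (y j).

Lemma sum_bern_prod {I : finType} (q : I -> R) : \sum_y bern_prod q y = 1.
Proof.
rewrite /bern_prod -(bigA_distr_bigA (fun j => bern (q j))) big1 // => j _.
by rewrite big_bool /= addrC subrK.
Qed.

Lemma bern_prod_ge0 {I : finType} (q : I -> R) y :
  (forall j, 0 <= q j <= 1) -> 0 <= bern_prod q y.
Proof.
by move=> q01; apply: prodr_ge0 => j _; have := q01 j; rewrite /bern; case: (y j); lra.
Qed.

Lemma bern_prod_variance {I : finType} (q x : I -> R) :
  \sum_y bern_prod q y * (\sum_j x j * ((y j)%:R - q j)) ^+ 2 =
  \sum_j x j ^+ 2 * (q j * (1 - q j)).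
Proof.
pose d j (b : bool) := x j * (b%:R - q j).
have moment j l : \sum_y bern_prod q y * (d j (y j) * d l (y l)) =
    if l == j then x j ^+ 2 * (q j * (1 - q j)) else 0.
  (* [D k m] is 1 off coordinate [k], which turns a one-coordinate factor into a product over all
     coordinates; the expectation then factors, and for [l != j] it contains a centred factor of
     mean zero. *)
  pose D k m b := if m == k then d m b else 1.
  have DE k (y : {ffun I -> bool}) : d k (y k) = \prod_m D k m (y m).
    by rewrite -big_mkcond big_pred1_eq.
  transitivity (\prod_m \sum_b (bern (q m) b * (D j m b * D l m b))).
    rewrite bigA_distr_bigA; apply: eq_bigr => y _.
    by rewrite !DE /bern_prod -!big_split.
  rewrite (bigD1 j) //= big_bool /= /D eqxx [j == l]eq_sym.
  case: (eqVneq l j) => [->|lj]; last by rewrite /d /=; ring.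
  rewrite big1 => [|m /negbTE mj]; first by rewrite /d /=; ring.
  by rewrite big_bool /= mj /=; ring.
under eq_bigr do rewrite expr2 mulr_suml mulr_sumr.
rewrite exchange_big; apply: eq_bigr => j _ /=.
under eq_bigr do rewrite mulr_sumr mulr_sumr.
rewrite exchange_big /= (eq_bigr _ (fun l _ => moment j l)).
by rewrite -big_mkcond big_pred1_eq.
Qed.

Lemma chebyshev_half {T : finType} (w f : T -> R) (s : R) :
  (forall y, 0 <= w y) -> \sum_y w y = 1 -> 0 <= s ->
  \sum_y w y * f y ^+ 2 <= s ^+ 2 / 2 -> 1 / 2 <= \sum_(y | `|f y| <= s) w y.
Proof.
move=> w0 w1 s0 var.
have wf0 y : 0 <= w y * f y ^+ 2 by rewrite mulr_ge0 ?sqr_ge0.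
suff : \sum_(y | ~~ (`|f y| <= s)) w y <= 1 / 2.
  by move: w1; rewrite (bigID (fun y => `|f y| <= s)) /=; lra.
(* At [s = 0] the second moment vanishes, so no mass lies where [f] is nonzero. *)
move: s0; rewrite le_eqVlt => /predU1P[s0|s0].
  rewrite -s0 expr0n mul0r in var *.
  have tot : \sum_y w y * f y ^+ 2 = 0 by apply/eqP; rewrite eq_le var sumr_ge0.
  rewrite big1 ?divr_ge0 // => y; rewrite normr_le0 => fy.
  have /eqP := @psumr_eq0P _ _ _ _ (fun y _ => wf0 y) tot y isT.
  by rewrite mulf_eq0 expf_eq0 /= (negbTE fy) orbF => /eqP.
have s20 : 0 < s ^+ 2 by rewrite exprn_gt0.
rewrite -(ler_pM2l s20) mulr_sumr; apply: (@le_trans _ _ (\sum_y w y * f y ^+ 2)); last by lra.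
rewrite [leRHS](bigID (fun y => `|f y| <= s)) /=.
apply: ler_wpDl; first exact: sumr_ge0.
apply: ler_sum => y; rewrite -ltNge mulrC => sy.
rewrite ler_wpM2l // -(real_normK (num_real (f y))).
by rewrite lerXn2r ?nnegrE ?(ltW s0) ?(ltW sy).
Qed.

(* Pigeonhole over the bins of width [e * s] covering [-s, s]. *)
Lemma collision_lower_bound {T : finType} (w f : T -> R) (s e : R) :
  (forall y, 0 <= w y) -> 0 <= s -> 0 < e <= 1 ->
  e / 3 * (\sum_(y | `|f y| <= s) w y) ^+ 2 <=
  \sum_y \sum_y' w y * w y' * (`|f y - f y'| <= e * s)%R%:R.
Proof.
move=> w0 s0 /andP[e0 e1].
(* The successor leaves room for a partial last bin and for the endpoint [f y = s]; [e <= 1] keeps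
   [N <= 3 / e]. For [s = 0] division by zero gives 0, and all points share bin 0. *)
pose N := (Num.truncn (2 / e)).+1.
have N0 : (0 : R) < N%:R by rewrite ltr0n.
have Ne : N%:R <= 3 / e.
  have /truncn_itv /andP[h _] : 0 <= 2 / e by rewrite divr_ge0 // ltW.
  have : 1 <= 1 / e by rewrite ler_pdivlMr ?mul1r.
  by rewrite /N -natr1; lra.
pose bin y := Num.truncn ((f y + s) / (e * s)).
have binN y : `|f y| <= s -> (bin y < N)%N.
  rewrite ler_norml => /andP[f1 f2]; rewrite ltnS; apply: le_truncn.
  have [->|sn0] := eqVneq s 0; first by rewrite mulr0 invr0 mulr0 divr_ge0 // ltW.
  have sp : 0 < s by rewrite lt_def sn0.
  rewrite ler_pdivrMr ?mulr_gt0 // mulrA divfK ?gt_eqF //; lra.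
have same y y' : `|f y| <= s -> `|f y'| <= s -> bin y = bin y' ->
    `|f y - f y'| <= e * s.
  rewrite !ler_norml => /andP[f1 f2] /andP[g1 g2] /[dup] bb.
  have [s00|sn0] := eqVneq s 0; first by move=> _; rewrite s00 in f1 f2 g1 g2 *; lra.
  have sp : 0 < e * s by rewrite mulr_gt0 // lt_def sn0.
  have /truncn_itv/andP : 0 <= (f y + s) / (e * s) by rewrite divr_ge0 ?(ltW sp) //; lra.
  have /truncn_itv/andP : 0 <= (f y' + s) / (e * s) by rewrite divr_ge0 ?(ltW sp) //; lra.
  rewrite -/(bin y) -/(bin y') => -[] + + [] + + h; rewrite h -natr1.
  rewrite !ler_pdivlMr // !ltr_pdivrMr //; lra.
pose G y := `|f y| <= s.
pose a (b : 'I_N) := \sum_(y | G y && (bin y == b)) w y.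
have binE (F : T -> R) :
    \sum_(y | G y) F y = \sum_(b < N) \sum_(y | G y && (bin y == b)) F y.
  rewrite (partition_big (fun y => inord (bin y) : 'I_N) xpredT) //=.
  apply: eq_bigr => b _; apply: eq_bigl => y; case Gy: (G y) => //=.
  by rewrite -(inj_eq val_inj) /= inordK ?binN.
set A := \sum_(y | _) w y.
have AE : A = \sum_b a b by exact: binE.
(* Cauchy-Schwarz, read off from the sum of squared deviations of the [a b] from their mean
   [A / N]. *)
have cs : A ^+ 2 / N%:R <= \sum_b a b ^+ 2.
  have : 0 <= \sum_b (a b - A / N%:R) ^+ 2 by apply: sumr_ge0 => b _; exact: sqr_ge0.
  have -> : \sum_b (a b - A / N%:R) ^+ 2 =
      \sum_b a b ^+ 2 - (A / N%:R) * 2 * A + N%:R * (A / N%:R) ^+ 2.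
    move: (A / N%:R) => m.
    rewrite (eq_bigr (fun b => a b ^+ 2 - m * 2 * a b + m ^+ 2)); last by move=> b _; ring.
    by rewrite big_split sumrB -mulr_sumr -AE sumr_const card_ord mulr_natl.
  have -> : N%:R * (A / N%:R) ^+ 2 = A ^+ 2 / N%:R by field; rewrite gt_eqF.
  have -> : A / N%:R * 2 * A = 2 * (A ^+ 2 / N%:R) by ring.
  by lra.
apply: (@le_trans _ _ (A ^+ 2 / N%:R)).
  rewrite mulrC ler_wpM2l ?sqr_ge0 // -[e / 3]invf_div lef_pV2 ?posrE //.
  by rewrite divr_gt0.
apply: le_trans cs _.
have -> : \sum_b a b ^+ 2 = \sum_(y | G y) \sum_(y' | G y' && (bin y' == bin y)) w y * w y'.
  rewrite binE; apply: eq_bigr => b _; rewrite expr2 {1}/a mulr_suml.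
  apply: eq_bigr => y /andP[_ /eqP yb]; rewrite /a mulr_sumr.
  by apply: eq_bigl => y'; rewrite yb.
rewrite [leRHS](bigID G) /=; apply: ler_wpDr.
  by apply: sumr_ge0 => y _; apply: sumr_ge0 => y' _; rewrite !mulr_ge0.
apply: ler_sum => y Gy.
rewrite [leRHS](bigID (fun y' => G y' && (bin y' == bin y))) /=; apply: ler_wpDr.
  by apply: sumr_ge0 => y' _; rewrite !mulr_ge0.
by apply: ler_sum => y' /andP[Gy' /eqP bb]; rewrite same ?mulr1.
Qed.

(* The head [H] is empty with constant probability, and then Chebyshev puts
   half of the mass of [T] in a window of width [2 * s]. *)
Lemma bern_small_ball (n k : nat) (p s e : R) (x : 'I_n -> R) (H : {set 'I_n}) :
  (2 <= k)%N -> 0 <= p <= 1 / 2 -> p * (1 - p) = (2 * k%:R)^-1 ->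
  (#|H| <= k)%N -> 0 <= s -> \sum_(j | j \notin H) x j ^+ 2 <= s ^+ 2 * k%:R ->
  0 < e <= 1 ->
  expR (- 4) / 12 * e <=
  \sum_y \sum_y' bern_prod (fun=> p) y * bern_prod (fun=> p) y' *
    (`|\sum_j x j * ((y j)%:R - (y' j)%:R)| <= e * s)%R%:R.
Proof.
move=> k2 /andP[p0 p2] pk Hk s0 xs e01.
have kR : (2 : R) <= k%:R by rewrite (ler_nat _ 2 k).
have p1 : 0 <= 1 - p by lra.
(* With these parameters [nu] is the law conditioned on an empty head, and its mean is the centre of
   the window. *)
pose q j := if j \in H then 0 else p.
have q01 j : 0 <= q j <= 1 by rewrite /q; case: ifP; lra.
pose nu := bern_prod q.
have nu0 y : 0 <= nu y by exact: bern_prod_ge0.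
pose f (y : {ffun 'I_n -> bool}) := \sum_j x j * ((y j)%:R - q j).
have fB y y' : f y - f y' = \sum_j x j * ((y j)%:R - (y' j)%:R).
  by rewrite /f -sumrB; apply: eq_bigr => j _; ring.
have half : 1 / 2 <= \sum_(y | `|f y| <= s) nu y.
  apply: chebyshev_half => //; first by exact: sum_bern_prod.
  rewrite bern_prod_variance (bigID (mem H)) /= big1 ?add0r; last first.
    by move=> j jH; rewrite /q jH mul0r mulr0.
  rewrite (eq_bigr (fun j => x j ^+ 2 * (2 * k%:R)^-1)); last first.
    by move=> j jH; rewrite /q (negbTE jH) pk.
  rewrite -mulr_suml ler_pdivrMr ?mulr_gt0 //; last by lra.
  by apply: le_trans xs _; rewrite mulrA divfK ?pnatr_eq0.
(* Either [y] meets the head and [nu y = 0], or the two weights differ by the factor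
   [(1 - p) ^+ #|H|], which is at least [(1 - p) ^+ k] and hence at least [expR (- 2)]. *)
have head y : expR (- 2) * nu y <= bern_prod (fun=> p) y.
  (* From [k p (1 - p) = 1/2] and [p <= 1/2] follows [p <= 1/k]; then [(1 + 2/k) (1 - p) >= 1]
     because [k >= 2]. *)
  have pexp : expR (- (2 / k%:R)) <= 1 - p.
    have k0 : 0 < (k%:R : R) by lra.
    have kp : k%:R * p <= 1.
      have : k%:R * p * (1 - p) = 1 / 2 by rewrite -mulrA pk; field; rewrite gt_eqF.
      nra.
    have ek : 1 + 2 / k%:R <= expR (2 / k%:R) :> R by exact: expR_ge1Dx.
    rewrite expRN -[leRHS]invrK lef_pV2 ?posrE ?expR_gt0 ?invr_gt0 //; last by lra.
    apply: le_trans ek; rewrite -[leLHS]mul1r ler_pdivrMr; last by lra.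
    have pu : p <= k%:R^-1 by rewrite -[leRHS]mul1r ler_pdivlMr // mulrC.
    have u2 : k%:R^-1 <= 2^-1 :> R by rewrite lef_pV2 ?posrE.
    have aux (u : R) : 0 < u -> p <= u -> u <= 2^-1 -> 1 <= (1 + 2 * u) * (1 - p).
      move=> u_gt0 p_le u_le.
      have : 0 <= (u - p) * (1 + 2 * u) by apply: mulr_ge0; lra.
      have : 0 <= u * (2^-1 - u) by apply: mulr_ge0; lra.
      by lra.
    by apply: aux => //; rewrite invr_gt0.
  have headH : expR (- 2) <= (1 - p) ^+ #|H|.
    apply: (@le_trans _ _ (expR (- (2 / k%:R)) ^+ #|H|)).
      rewrite -expRM_natr ler_expR mulNr lerN2 -mulrA ler_piMr //.
      by rewrite mulrC ler_pdivrMr ?mul1r ?ler_nat //; lra.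
    by apply: lerXn2r pexp; rewrite nnegrE ?expR_ge0 ?p1.
  rewrite /nu /bern_prod (bigID (mem H)) [leRHS](bigID (mem H)) /= mulrA.
  set X := \prod_(j | j \notin H) _; set Y := \prod_(j | j \notin H) _.
  have -> : X = Y by apply: eq_bigr => j /negbTE jH; rewrite /q jH.
  have Y0 : 0 <= Y by apply: prodr_ge0 => j _; rewrite /bern; case: ifP; lra.
  rewrite ler_wpM2r //.
  case: (boolP [exists j in H, y j]) => [/existsP[j /andP[jH yj]]|/existsPn yH].
    rewrite (bigD1 j) //= /q jH yj /= mul0r mulr0.
    by apply: prodr_ge0 => l _; rewrite /bern; case: ifP; lra.
  have yF j : j \in H -> y j = false.
    by move=> jH; have := yH j; rewrite jH /= => /negbTE.
  rewrite big1 ?mulr1; last by move=> j jH; rewrite /q jH yF //= subr0.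
  rewrite (eq_bigr (fun=> 1 - p)) => [|j jH]; last by rewrite yF.
  by rewrite prodr_const.
(* Each of the two vectors costs a factor [expR (- 2)]; the rest is [e / 3] times [(1 / 2) ^+ 2]. *)
apply: le_trans (_ : expR (- 4) * \sum_y \sum_y' nu y * nu y' * (`|f y - f y'| <= e * s)%R%:R <= _).
  have [e0 e1] := andP e01.
  rewrite -mulrA ler_wpM2l ?expR_ge0 //.
  apply: le_trans (collision_lower_bound nu f _ _ nu0 s0 e01).
  have : (1 / 2) ^+ 2 <= (\sum_(y | `|f y| <= s) nu y) ^+ 2.
    by apply: lerXn2r half; rewrite nnegrE ?sumr_ge0 ?divr_ge0.
  by nra.
have -> : expR (- 4) = expR (- 2) * expR (- 2) :> R by rewrite -expRD; congr expR; ring.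
rewrite mulr_sumr; apply: ler_sum => y _; rewrite mulr_sumr; apply: ler_sum => y' _.
by rewrite fB mulrA ler_wpM2r // mulrACA ler_pM // mulr_ge0 // expR_ge0.
Qed.

End AntiConcentration.

(** * The law of the error of one row *)

Section RowError.
Context {R : realType}.

(** Bucket and sign of a coordinate form one pair, so that a row is a single function with
    independent uniform values. *)
Definition row_err {n k} (x : 'I_n -> R) (i : 'I_n)
    (g : {ffun 'I_n -> 'I_k * bool}) : R :=
  \sum_(j | (j != i) && ((g j).1 == (g i).1)) sgn R (g i).2 * sgn R (g j).2 * x j.

(** [None] marks a coordinate outside the bucket of [i], [Some b] a collision with relative sign
    [b]. *)
Definition osgn (o : option bool) : R := if o is Some b then sgn R b else 0.

Definition osgn_law (k : nat) (o : option bool) : R :=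
  if o is Some _ then (2 * k%:R)^-1 else 1 - k%:R^-1.

Lemma sgnM (b c : bool) : sgn R b * sgn R c = sgn R (c == b).
Proof. by case: b; case: c; rewrite /sgn /= ?mulr1 ?mul1r ?mulN1r ?opprK. Qed.

(** Writing the event [g i = c] as a product weight makes [sum_prod_pushforward] applicable to
    it. *)
Lemma prod_set_coordinate (n k : nat) (i : 'I_n) (c : 'I_k * bool)
    (g : {ffun 'I_n -> 'I_k * bool}) :
  \prod_j (if j == i then (g j == c)%:R else (2 * k%:R)^-1) =
  (g i == c)%:R * (2 * k%:R)^-1 ^+ n.-1 :> R.
Proof.
rewrite (bigD1 i) //= eqxx; congr (_ * _).
rewrite (eq_bigr (fun=> (2 * k%:R)^-1)) => [|j /negbTE ->//].
by rewrite prodr_const cardC1 card_ord.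
Qed.

(* Conditioning on the hash values [c] of [i]. *)
Lemma unif_prob_row (n k : nat) (i : 'I_n) (E : pred {ffun 'I_n -> 'I_k * bool}) :
  unif_prob R E = \sum_c (2 * k%:R)^-1 *
    \sum_(g : {ffun 'I_n -> 'I_k * bool}) (\prod_j (if j == i then (g j == c)%:R else (2 * k%:R)^-1)) * (E g)%:R.
Proof.
rewrite unif_probE card_ffun card_prod card_ord card_bool natrX natrM.
rewrite (partition_big (fun g : {ffun 'I_n -> 'I_k * bool} => g i) xpredT) //=.
rewrite mulr_suml; apply: eq_bigr => c _.
rewrite mulr_suml mulr_sumr big_mkcond; apply: eq_bigr => g _ /=.
rewrite prod_set_coordinate; case: eqP => _; last by rewrite !mul0r mulr0.
rewrite mul1r mulrA -exprS prednK; last by apply: leq_ltn_trans (ltn_ord i).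
by rewrite mulrC exprVn card_ord [k%:R * _]mulrC.
Qed.

(** Away from [i], each [Some b] has one preimage, of mass [1/(2k)]; the other [k - 1] buckets make
    up the mass [1 - 1/k] of [None]. Coordinate [i] is held at [None], as it is no part of the
    error. *)
Lemma sketch_pushforward (n k : nat) (i : 'I_n) (c : 'I_k * bool)
    (F : {ffun 'I_n -> option bool} -> R) :
  (0 < k)%N ->
  \sum_(g : {ffun 'I_n -> 'I_k * bool}) (\prod_j (if j == i then (g j == c)%:R else (2 * k%:R)^-1)) *
    F [ffun j => if (j != i) && ((g j).1 == c.1) then Some ((g j).2 == c.2) else None] =
  \sum_(z : {ffun 'I_n -> option bool})
    (\prod_j (if j == i then (z j == None)%:R else osgn_law k (z j))) * F z.
Proof.
move=> k0; have kR : (k%:R : R) != 0 by rewrite pnatr_eq0 -lt0n.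
rewrite (sum_prod_pushforward
  (fun j (a : 'I_k * bool) => if j == i then (a == c)%:R else (2 * k%:R)^-1)
  (fun j (a : 'I_k * bool) =>
     if (j != i) && (a.1 == c.1) then Some (a.2 == c.2) else None)).
apply: eq_bigr => z _; congr (_ * _); apply: eq_bigr => j _.
case: eqVneq => [ji|ji] /=.
  case: (z j) => [b|] /=; first by rewrite big_pred0.
  by rewrite (bigD1 c) //= eqxx big1 ?addr0 // => a /negbTE ->.
rewrite big_mkcond /=.
rewrite -(pair_bigA _ (fun v b => if (if v == c.1 then Some (b == c.2) else None) == z j
  then (2 * k%:R)^-1 else 0 : R)) /=.
rewrite (bigD1 c.1) //= eqxx.
rewrite [X in _ + X](eq_bigr (fun=> if None == z j then k%:R^-1 else 0)); last first.
  move=> v /negbTE ->; rewrite big_bool /=; case: ifP => _; last by rewrite addr0.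
  by field.
rewrite sumr_const cardC1 card_ord big_bool.
case: c => v b /=; case: (z j) => [b'|] /=; first by case: b; case: b'; rewrite /= mul0rn ?addr0 ?add0r.
have kS : (k.-1%:R : R) = k%:R - 1 by rewrite -[in RHS](prednK k0) -natr1 addrK.
by rewrite !add0r -[_ *+ k.-1]mulr_natr kS; field.
Qed.

(** [y j - y' j] is 1 or -1 with probability [p (1 - p)] each, and [y j] encodes its sign where the
    two differ. The resulting law is that of [sketch_pushforward]. *)
Lemma bern_pushforward (n k : nat) (i : 'I_n) (p : R)
    (F : {ffun 'I_n -> option bool} -> R) :
  p * (1 - p) = (2 * k%:R)^-1 -> (0 < k)%N ->
  \sum_(y : {ffun 'I_n -> bool}) \sum_(y' : {ffun 'I_n -> bool})
    bern_prod (fun=> p) y * bern_prod (fun=> p) y' *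
    F [ffun j => if (j != i) && (y j != y' j) then Some (y j) else None] =
  \sum_(z : {ffun 'I_n -> option bool})
    (\prod_j (if j == i then (z j == None)%:R else osgn_law k (z j))) * F z.
Proof.
move=> pk k0; have kR : (k%:R : R) != 0 by rewrite pnatr_eq0 -lt0n.
have pk2 : k%:R^-1 = 2 * (p * (1 - p)) by rewrite pk; field.
pose ff1 (g : {ffun 'I_n -> bool * bool}) : {ffun 'I_n -> bool} := [ffun j => (g j).1].
pose ff2 (g : {ffun 'I_n -> bool * bool}) : {ffun 'I_n -> bool} := [ffun j => (g j).2].
rewrite pair_bigA (reindex (fun g => (ff1 g, ff2 g))) /=; last first.
  exists (fun y : {ffun 'I_n -> bool} * {ffun 'I_n -> bool} =>
    [ffun j => (y.1 j, y.2 j)]) => [g _|[y y'] _].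
    by apply/ffunP => j; rewrite !ffunE; case: (g j).
  by congr (_, _); apply/ffunP => j; rewrite !ffunE.
transitivity (\sum_(g : {ffun 'I_n -> bool * bool})
    (\prod_j (bern p (g j).1 * bern p (g j).2)) *
    F [ffun j => if (j != i) && ((g j).1 != (g j).2) then Some (g j).1 else None]).
  apply: eq_bigr => g _; congr (_ * F _).
    by rewrite /bern_prod -big_split; apply: eq_bigr => j _; rewrite !ffunE.
  by apply/ffunP => j; rewrite !ffunE.
rewrite (sum_prod_pushforward (fun _ (a : bool * bool) => bern p a.1 * bern p a.2)
  (fun j (a : bool * bool) => if (j != i) && (a.1 != a.2) then Some a.1 else None)).
apply: eq_bigr => z _; congr (_ * _); apply: eq_bigr => j _.
rewrite big_mkcond -(pair_bigA _ (fun v b =>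
  if (if (j != i) && (v != b) then Some v else None) == z j
  then bern p v * bern p b else 0)) /= !big_bool /=.
case: (eqVneq j i) => _ /=; case: (z j) => [b|] /=; rewrite ?addr0 //; first by ring.
  by rewrite -pk; case: b => /=; ring.
by rewrite pk2; ring.
Qed.

Lemma row_err_small_ball (n k : nat) (x : 'I_n -> R) (i : 'I_n) (H : {set 'I_n}) (s e : R) :
  (2 <= k)%N -> (#|H| <= k)%N -> 0 <= s ->
  \sum_(j | j \notin H) x j ^+ 2 <= s ^+ 2 * k%:R -> 0 < e <= 1 ->
  expR (- 4) / 12 * e <=
  unif_prob R (fun g : {ffun 'I_n -> 'I_k * bool} => `|row_err x i g| <= e * s).
Proof.
move=> k2 Hk s0 xs e01.
have kR : (2 : R) <= k%:R by rewrite (ler_nat _ 2 k).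
have k0 : (0 < k)%N by apply: leq_trans k2.
(* The smaller root of [p (1 - p) = 1 / (2 k)], real because [k >= 2]. *)
pose p : R := (1 - Num.sqrt (1 - 2 / k%:R)) / 2.
have D0 : 0 <= 1 - 2 / k%:R :> R by rewrite subr_ge0 ler_pdivrMr ?mul1r //; lra.
have pk : p * (1 - p) = (2 * k%:R)^-1.
  have := sqr_sqrtr D0; rewrite /p; set q := Num.sqrt _ => qq.
  have -> : (1 - q) / 2 * (1 - (1 - q) / 2) = (1 - q ^+ 2) / 4 by field.
  by rewrite qq; field; lra.
have p01 : 0 <= p <= 1 / 2.
  have q1 : Num.sqrt (1 - 2 / k%:R) <= 1 :> R.
    by rewrite -[leRHS]sqrtr1 ler_wsqrtr // gerBl divr_ge0.
  by have := sqrtr_ge0 (1 - 2 / k%:R : R); rewrite /p; lra.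
(* The Bernoulli sum runs over [i] as well, so the coefficient there is set to 0. *)
pose x' j := if j == i then 0 else x j.
pose F (z : {ffun 'I_n -> option bool}) : R :=
  (`|\sum_j x' j * osgn (z j)| <= e * s)%R%:R.
have x's : \sum_(j | j \notin H) x' j ^+ 2 <= s ^+ 2 * k%:R.
  apply: le_trans xs; apply: ler_sum => j _; rewrite /x'.
  by case: eqP => // _; rewrite expr0n sqr_ge0.
have := bern_small_ball n k p s e x' H k2 p01 pk Hk s0 x's e01.
set Q := _ * e; set S := (X in Q <= X) => QS.
have SE : S = \sum_(z : {ffun 'I_n -> option bool})
    (\prod_j (if j == i then (z j == None)%:R else osgn_law k (z j))) * F z.
  rewrite -(bern_pushforward n k i p) //; apply: eq_bigr => y _; apply: eq_bigr => y' _.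
  congr (_ * _); rewrite /F; congr ((`|_| <= _)%R%:R); apply: eq_bigr => j _.
  rewrite ffunE /x'; case: eqVneq => _ /=; first by rewrite !mul0r.
  by congr (_ * _); case: (y j); case: (y' j); rewrite /= ?subrr ?subr0 ?sub0r.
rewrite (unif_prob_row n k i).
have -> : Q = \sum_(c : 'I_k * bool) (2 * k%:R)^-1 * Q.
  rewrite sumr_const card_prod card_ord card_bool -[RHS]mulr_natl natrM.
  by field; lra.
apply: ler_sum => c _; rewrite ler_pM2l ?invr_gt0; last lra.
apply: le_trans QS _; rewrite SE -(sketch_pushforward n k i c F k0).
apply: ler_sum => g _; rewrite prod_set_coordinate.
case: eqP => [gi|_]; last by rewrite !mul0r.
suff -> : row_err x i g =
    \sum_j x' j * osgn ([ffun j => if (j != i) && ((g j).1 == c.1)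
                       then Some ((g j).2 == c.2) else None] j) by [].
rewrite /row_err big_mkcond gi; apply: eq_bigr => j _; rewrite ffunE /x'.
case: (eqVneq j i) => _ /=; first by rewrite mul0r.
by case: eqP => _ /=; rewrite ?mulr0 // sgnM mulrC.
Qed.

(** Flipping the sign of [i] alone preserves the uniform measure and negates the error, so both
    tails are equal; with the ball they have total mass 1. *)
Lemma row_err_tail (n k : nat) (x : 'I_n -> R) (i : 'I_n) (tau : R) (a : R) :
  0 <= tau ->
  2 * a <= unif_prob R (fun g : {ffun 'I_n -> 'I_k * bool} => `|row_err x i g| <= tau) ->
  (0 < k)%N ->
  unif_prob R (fun g : {ffun 'I_n -> 'I_k * bool} => tau < row_err x i g) <= 1 / 2 - a /\
  unif_prob R (fun g : {ffun 'I_n -> 'I_k * bool} => row_err x i g < - tau) <= 1 / 2 - a.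
Proof.
move=> t0 ha k0.
pose flip (g : {ffun 'I_n -> 'I_k * bool}) :=
  [ffun j => if j == i then ((g j).1, ~~ (g j).2) else g j].
have flipK : involutive flip.
  move=> g; apply/ffunP => j; rewrite !ffunE; case: eqP => // _ /=.
  by rewrite negbK; case: (g j).
have flipN g : row_err x i (flip g) = - row_err x i g.
  rewrite /row_err -sumrN /flip; apply: eq_big => j.
    by rewrite !ffunE eqxx /=; case: eqVneq.
  move=> /andP[ji _]; rewrite !ffunE eqxx /= (negbTE ji) -!mulNr; congr (_ * _ * _).
  by case: (g i).2; rewrite /sgn ?opprK.
have symm : unif_prob R (fun g : {ffun 'I_n -> 'I_k * bool} => row_err x i g < - tau) =
    unif_prob R (fun g : {ffun 'I_n -> 'I_k * bool} => tau < row_err x i g).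
  rewrite -(unif_prob_bij flip _ (inv_bij flipK)) !unif_probE; congr (_ / _).
  by apply: eq_bigr => g _ /=; rewrite flipN ltrN2.
suff tot : unif_prob R (fun g : {ffun 'I_n -> 'I_k * bool} => tau < row_err x i g) +
    unif_prob R (fun g : {ffun 'I_n -> 'I_k * bool} => row_err x i g < - tau) +
    unif_prob R (fun g : {ffun 'I_n -> 'I_k * bool} => `|row_err x i g| <= tau) = 1.
  by split; lra.
rewrite !unif_probE -!mulrDl -!big_split /=.
rewrite (eq_bigr (fun=> 1)) => [|g _].
  rewrite sumr_const divff // pnatr_eq0 -lt0n card_ffun card_prod card_ord card_bool.
  by rewrite expn_gt0 muln_gt0 k0.
rewrite ler_norml; case: (ltrP tau); case: (ltrP _ (- tau)) => /=; lra.
Qed.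

End RowError.

(** * Regrouping the sketch into independent rows *)

Section Rows.
Context {R : realType} {n r k : nat}.

Definition sketch_rows (w : CSspace r n k) : {ffun 'I_r -> {ffun 'I_n -> 'I_k * bool}} :=
  [ffun u => [ffun j => (w.1 (u, j), w.2 (u, j))]].

(** Transports the uniform law on sketches to independent uniform rows, the form in which the
    Chernoff bound applies. *)
Lemma sketch_rows_bij : bijective sketch_rows.
Proof.
exists (fun g : {ffun 'I_r -> {ffun 'I_n -> 'I_k * bool}} =>
  ([ffun uj : 'I_r * 'I_n => (g uj.1 uj.2).1] : {ffun 'I_r * 'I_n -> 'I_k},
   [ffun uj : 'I_r * 'I_n => (g uj.1 uj.2).2] : {ffun 'I_r * 'I_n -> bool})).
  by move=> [h s]; congr (_, _); apply/ffunP => -[u j]; rewrite !ffunE.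
by move=> g; apply/ffunP => u; apply/ffunP => j; rewrite !ffunE /=; case: (g u j).
Qed.

Lemma row_estimate (w : CSspace r n k) (x : 'I_n -> R) (i : 'I_n) (u : 'I_r) :
  sgn R (w.2 (u, i)) * cs_y w x u (w.1 (u, i)) = x i + row_err x i (sketch_rows w u).
Proof.
rewrite /cs_y (bigD1 i) //= mulrDr mulrA sgnM eqxx /sgn mul1r; congr (_ + _).
rewrite mulr_sumr; apply: eq_big => j; first by rewrite !ffunE /= andbC.
by rewrite !ffunE /= mulrA.
Qed.

Lemma count_row_estimates (w : CSspace r n k) (x : 'I_n -> R) (i : 'I_n) (P : pred R) :
  count P [seq sgn R (w.2 (u, i)) * cs_y w x u (w.1 (u, i)) | u : 'I_r] =
  #|[set u | P (x i + row_err x i (sketch_rows w u))]|.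
Proof.
rewrite count_map cardsE cardE -size_filter enumT /enum_mem; congr (size _).
by apply: eq_filter => u; rewrite /= row_estimate.
Qed.

Lemma size_row_estimates (w : CSspace r n k) (x : 'I_n -> R) (i : 'I_n) :
  size [seq sgn R (w.2 (u, i)) * cs_y w x u (w.1 (u, i)) | u : 'I_r] = r.
Proof. by rewrite size_map size_enum_ord. Qed.

Lemma cs_est_gt (w : CSspace r n k) (x : 'I_n -> R) (i : 'I_n) (tau : R) :
  (0 < r)%N -> x i + tau < cs_est w x i ->
  (r <= (#|[set u | (tau < row_err x i (sketch_rows w u))%R]|).*2)%N.
Proof.
move=> r0 /count_ge_median; rewrite -size_eq0 size_row_estimates -lt0n => /(_ r0).
rewrite count_row_estimates; congr (_ <= (#|pred_of_set _|).*2)%N.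
by apply/setP => u; rewrite !inE ltrD2l.
Qed.

Lemma cs_est_lt (w : CSspace r n k) (x : 'I_n -> R) (i : 'I_n) (tau : R) :
  (0 < r)%N -> cs_est w x i < x i - tau ->
  (r <= (#|[set u | (row_err x i (sketch_rows w u) < - tau)%R]|).*2)%N.
Proof.
move=> r0 /count_le_median; rewrite -size_eq0 size_row_estimates -lt0n => /(_ r0).
rewrite count_row_estimates; congr (_ <= (#|pred_of_set _|).*2)%N.
by apply/setP => u; rewrite !inE ltrD2l.
Qed.

End Rows.

(** * The tail bound for the estimate *)

Theorem theorem1p1 (R : realType) :
  exists c : R, 0 < c /\
  forall (n r k : nat) (x : 'I_n -> R) (t : R) (i : 'I_n),
    (1 <= n)%N -> (1 <= r)%N -> (2 <= k)%N -> t <= r%:R ->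
    unif_prob R
      (fun w : CSspace r n k =>
         (cs_est w x i - x i) ^+ 2 > t / r%:R * (tail_sqnorm x k / k%:R))
    < 2 * expR (- (c * t)).
Proof.
pose K : R := expR (- 4) / 12.
have K0 : 0 < K by rewrite divr_gt0 ?expR_gt0.
have K1 : K <= 1.
  have : expR (- 4) <= 1 :> R by rewrite -[leRHS]expR0 ler_expR oppr_le0.
  by rewrite /K; lra.
(* The Chernoff bound gives the exponent [K ^+ 2 / 8 * t]; half of it makes the inequality
   strict. *)
exists (K ^+ 2 / 16); split; first by rewrite divr_gt0 ?exprn_gt0.
move=> n r k x t i _ r1 k2 tr.
(* For [t <= 0] the right-hand side is at least 2. *)
have [t0|t0] := leP t 0.
  apply: le_lt_trans (unif_prob_le1 _) _.
  have : 1 <= expR (- (K ^+ 2 / 16 * t)).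
    by rewrite -[leLHS]expR0 ler_expR oppr_ge0 mulr_ge0_le0 // divr_ge0 ?sqr_ge0.
  by lra.
have rR : 0 < (r%:R : R) by rewrite ltr0n.
have kR : 0 < (k%:R : R) by rewrite ltr0n (leq_trans _ k2).
have [H Hk xH] := tail_sqnormE n x k.
have tail0 : 0 <= tail_sqnorm x k by rewrite -xH sumr_ge0 // => j _; exact: sqr_ge0.
pose s := Num.sqrt (tail_sqnorm x k / k%:R).
pose e := Num.sqrt (t / r%:R).
have e2 : e ^+ 2 = t / r%:R by rewrite sqr_sqrtr // divr_ge0 ?(ltW t0).
have s2 : s ^+ 2 = tail_sqnorm x k / k%:R by rewrite sqr_sqrtr // divr_ge0.
have s0 : 0 <= s by exact: sqrtr_ge0.
(* Here [t <= r] enters. *)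
have e01 : 0 < e <= 1.
  rewrite sqrtr_gt0 divr_gt0 //= -[leRHS]sqrtr1 ler_wsqrtr //.
  by rewrite ler_pdivrMr ?mul1r.
have [e0 e1] := andP e01.
have es0 : 0 <= e * s by rewrite mulr_ge0 // ltW.
have ball : 2 * (K / 2 * e) <=
    unif_prob R (fun g : {ffun 'I_n -> 'I_k * bool} => `|row_err x i g| <= e * s).
  have -> : 2 * (K / 2 * e) = K * e by field.
  by apply: (row_err_small_ball n k x i H) => //; rewrite s2 divfK ?xH // gt_eqF.
have [up lo] := row_err_tail n k x i (e * s) (K / 2 * e) es0 ball (leq_trans (isT : (0 < 2)%N) k2).
have a01 : 0 <= K / 2 * e <= 1 by apply/andP; split; nra.
have expo : (K / 2 * e) ^+ 2 / 2 * r%:R = K ^+ 2 / 8 * t.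
  by rewrite exprMn e2; field; rewrite gt_eqF.
have bound (P : pred {ffun 'I_n -> 'I_k * bool}) : unif_prob R P <= 1 / 2 - K / 2 * e ->
    unif_prob R (fun w : CSspace r n k =>
      (r <= (#|[set u | P (sketch_rows w u)]|).*2)%N) <= expR (- (K ^+ 2 / 8 * t)).
  move=> hP; rewrite -expo; apply: le_trans (chernoff_half P r _ a01 hP).
  by rewrite -(unif_prob_bij _ _ sketch_rows_bij).
apply: (@le_lt_trans _ _ (2 * expR (- (K ^+ 2 / 8 * t)))); last first.
  rewrite ltr_pM2l // ltr_expR ltrN2.
  have : 0 < K ^+ 2 * t by rewrite mulr_gt0 ?exprn_gt0.
  by lra.
(* The factor 2 is a union bound over the two tails of the median. *)
rewrite mulrDl mul1r; apply: le_trans (lerD (bound _ up) (bound _ lo)).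
apply: le_trans (unif_probU _ _); apply: unif_prob_le => w; rewrite !unfold_in /= => big.
have {big} : e * s < `|cs_est w x i - x i|.
  by rewrite ltNge; apply/negP => h; move: big; rewrite ltNge -e2 -s2 -exprMn
    -(real_normK (num_real (_ - _))) lerXn2r ?nnegrE.
rewrite lter_normr => /orP[h|h]; apply/orP.
  by left; apply: cs_est_gt => //; lra.
by right; apply: cs_est_lt => //; lra.
Qed.
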